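(* Let $R$ be a ring and let $G$ be an abelian group such that the group ring $RG$ is a GNC ring. Then $G$ is a $p$-group, where $p$ is a prime number belonging to $Nil(R)$.
   Context: Rings are associative with identity element $1$, not necessarily commutative. $Nil(R)$ is the set of nilpotent elements of $R$; $p\in Nil(R)$ means that $p\cdot 1_R$ is nilpotent. An element of a ring is nil-clean if it is the sum of an idempotent and a nilpotent element (not required to commute). A ring is GNC (generalized nil-clean) if every non-unit of it is nil-clean. $RG$ denotes the group ring of $G$ over $R$. For a prime number $p$, a $p$-group is a group in which every element has order a power of $p$.
   Formalization: The group G is assumed nontrivial and the ring R nonzero; the claim fails otherwise (R = Q with G trivial has no nilpotent prime; R = 0 with G = Z is not a p-group). *)

(* Defs.v *)
From HB Require Import structures.
From mathcomp Require Import all_boot all_algebra.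
From mathcomp Require Import finmap.
From mathcomp.multinomials Require Import monalg.

Set Implicit Arguments.
Unset Strict Implicit.
Unset Printing Implicit Defensive.

Import GRing.Theory.
Local Open Scope ring_scope.

(* The multiplication provided by monalg requires a monomType, which has no
   invertible element but 1; hence groups are excluded, and only the additive
   structure of {malg R[G]} (finitely supported functions G -> R) is reused,
   through an alias that carries the convolution product. *)
Definition group_ring (R : nzRingType) (G : groupType) : Type := {malg R[G]}.

Section GroupRing.
Context (R : nzRingType) (G : groupType).

#[warnings="-redundant-canonical-projection"]
HB.instance Definition _ := GRing.Zmodule.on (group_ring R G).

Implicit Types a b c : group_ring R G.

Definition group_ring_one : group_ring R G := << 1 *g (1%g : G) >>.

Definition group_ring_mul a b : group_ring R G :=
  \sum_(g <- msupp a) \sum_(h <- msupp b) << a@_g * b@_h *g (g * h)%g >>.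

Lemma group_ring_mulEw (A B : {fset G}) a b :
  (msupp a `<=` A)%fset -> (msupp b `<=` B)%fset ->
  group_ring_mul a b =
    \sum_(g <- A) \sum_(h <- B) << a@_g * b@_h *g (g * h)%g >>.
Proof.
move=> leA leB; rewrite /group_ring_mul (big_fset_incl _ leA) /=.
  apply: eq_bigr => g _; apply: big_fset_incl => // h _ /mcoeff_outdom ->.
  by rewrite mulr0 monalgU0.
move=> g _ /mcoeff_outdom ag.
by rewrite big1 // => h _; rewrite ag mul0r monalgU0.
Qed.

Lemma group_ring_mulUU x y g h :
  group_ring_mul << x *g g >> << y *g h >> = << x * y *g (g * h)%g >>.
Proof.
by rewrite (group_ring_mulEw msuppU_le msuppU_le) !big_seq_fset1 !mcoeffUU.
Qed.

Lemma group_ring_mulDl : left_distributive group_ring_mul +%R.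
Proof.
move=> a b c; have sub := fsubset_refl (msupp c).
rewrite (group_ring_mulEw (msuppD_le a b) sub).
rewrite (group_ring_mulEw (fsubsetUl (msupp a) (msupp b)) sub).
rewrite (group_ring_mulEw (fsubsetUr (msupp a) (msupp b)) sub).
rewrite -big_split /=; apply: eq_bigr => g _.
rewrite -big_split /=; apply: eq_bigr => h _.
by rewrite mcoeffD mulrDl monalgUD.
Qed.

Lemma group_ring_mulDr : right_distributive group_ring_mul +%R.
Proof.
move=> c a b; have sub := fsubset_refl (msupp c).
rewrite (group_ring_mulEw sub (msuppD_le a b)).
rewrite (group_ring_mulEw sub (fsubsetUl (msupp a) (msupp b))).
rewrite (group_ring_mulEw sub (fsubsetUr (msupp a) (msupp b))).
rewrite -big_split /=; apply: eq_bigr => g _.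
rewrite -big_split /=; apply: eq_bigr => h _.
by rewrite mcoeffD mulrDr monalgUD.
Qed.

Lemma group_ring_mul0r : left_zero 0 group_ring_mul.
Proof. by move=> a; rewrite /group_ring_mul msupp0 big_seq_fset0. Qed.

Lemma group_ring_mulr0 : right_zero 0 group_ring_mul.
Proof.
move=> a; rewrite /group_ring_mul big1 // => g _.
by rewrite msupp0 big_seq_fset0.
Qed.

Lemma group_ring_mul_suml (I : Type) (r : seq I) (F : I -> group_ring R G) a :
  group_ring_mul (\sum_(i <- r) F i) a = \sum_(i <- r) group_ring_mul (F i) a.
Proof.
exact: (big_morph (group_ring_mul^~ a)
  (fun x y => group_ring_mulDl x y a) (group_ring_mul0r a)).
Qed.

Lemma group_ring_mul_sumr (I : Type) (r : seq I) (F : I -> group_ring R G) a :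
  group_ring_mul a (\sum_(i <- r) F i) = \sum_(i <- r) group_ring_mul a (F i).
Proof.
exact: (big_morph (group_ring_mul a)
  (group_ring_mulDr a) (group_ring_mulr0 a)).
Qed.

Lemma group_ring_mul1r : left_id group_ring_one group_ring_mul.
Proof.
move=> a; rewrite [in LHS](monalgE a) group_ring_mul_sumr [RHS]monalgE.
by apply: eq_bigr => g _; rewrite group_ring_mulUU mul1r mul1g.
Qed.

Lemma group_ring_mulr1 : right_id group_ring_one group_ring_mul.
Proof.
move=> a; rewrite [in LHS](monalgE a) group_ring_mul_suml [RHS]monalgE.
by apply: eq_bigr => g _; rewrite group_ring_mulUU mulr1 mulg1.
Qed.

Lemma group_ring_mulA : associative group_ring_mul.
Proof.
move=> a b c; rewrite [a]monalgE.
rewrite [LHS]group_ring_mul_suml [in RHS](group_ring_mul_suml (msupp a)).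
rewrite [RHS]group_ring_mul_suml; apply: eq_bigr => g _.
rewrite [b]monalgE [in LHS](group_ring_mul_suml (msupp b)).
rewrite [LHS]group_ring_mul_sumr [in RHS](group_ring_mul_sumr (msupp b)).
rewrite [RHS]group_ring_mul_suml; apply: eq_bigr => h _.
rewrite [c]monalgE [in LHS](group_ring_mul_sumr (msupp c)).
rewrite [LHS]group_ring_mul_sumr [RHS]group_ring_mul_sumr.
by apply: eq_bigr => k _; rewrite !group_ring_mulUU mulrA mulgA.
Qed.

Lemma group_ring_oner_neq0 : group_ring_one != 0.
Proof. by rewrite monalgU_eq0 oner_eq0. Qed.

HB.instance Definition _ := GRing.Zmodule_isNzRing.Build (group_ring R G)
  group_ring_mulA group_ring_mul1r group_ring_mulr1
  group_ring_mulDl group_ring_mulDr group_ring_oner_neq0.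

End GroupRing.

Section NilClean.
Context (R : nzRingType).
Implicit Types x e : R.

Definition nilpotent_elt x : Prop := exists n : nat, x ^+ n = 0.

Definition idempotent_elt e : Prop := e * e = e.

(* R is not a unitRingType in general, so GRing.unit is not available. *)
Definition two_sided_unit x : Prop := exists y, x * y = 1 /\ y * x = 1.

Definition nil_clean x : Prop :=
  exists e q, [/\ idempotent_elt e, nilpotent_elt q & x = e + q].

End NilClean.

Definition GNC (R : nzRingType) : Prop :=
  forall x : R, ~ two_sided_unit x -> nil_clean x.

Section PGroup.
Context (G : groupType).

(* G may be infinite, so the orders #[g] of finGroupType do not apply. *)
Definition has_order (g : G) (n : nat) : Prop :=
  [/\ (0 < n)%N, (g ^+ n = 1)%g
    & forall m : nat, (0 < m < n)%N -> (g ^+ m <> 1)%g].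

Definition is_pgroup (p : nat) : Prop :=
  forall g : G, exists k : nat, has_order g (p ^ k).

Definition is_abelian : Prop := forall g h : G, commute g h.

End PGroup.

(* Main.v *)
(** For g in G the element 1 - g is central and has augmentation 0, hence is
    not a unit; being nil-clean and central, it satisfies that
    (1 - g) - (1 - g)^2 = (1 - g) g is nilpotent, and so is 1 - g since g is a
    central unit. If g had infinite order, the coefficient of 1 in (1 - g)^m
    would be 1, so every g is torsion. If t = 1 - g is nilpotent, nonzero and
    (1 - t)^n = 1, expanding gives n t = t^2 v with v commuting with t, so
    n^k t = t^(k+1) v^k = 0 for large k; the coefficient of 1 in t is 1, so n is
    nilpotent in R. Hence every prime dividing the order of an element is
    nilpotent in R, and two distinct primes cannot both be. *)
Require Import Defs.
From mathcomp Require Import all_boot all_algebra.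
From mathcomp.multinomials Require Import monalg.

Set Implicit Arguments.
Unset Strict Implicit.
Unset Printing Implicit Defensive.

Import GRing.Theory.
Local Open Scope ring_scope.

Section Nilpotent.
Context (A : nzRingType).
Implicit Types x t : A.

(** Writing [x = e + q], centrality of [x] makes [e] and [q] commute, so
    [x * (1 - x) = q * (1 - e - x)] is a product of commuting factors, one of them nilpotent. *)
Lemma nil_clean_central_nilpotent x :
  (forall y, GRing.comm x y) -> nil_clean x -> nilpotent_elt (x * (1 - x)).
Proof.
move=> cx [e [q [ee [n qn] xE]]]; exists n.
have cqe : q * e = e * q.
  by have := cx e; rewrite /GRing.comm xE mulrDl mulrDr => /addrI.
have cq : GRing.comm q (1 - e - x).
  by do ![apply: commrB] => //; [exact: commr1 | exact/commr_sym/cx].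
have -> : x * (1 - x) = q * (1 - e - x).
  have -> : q * (1 - e - x) = q * (1 - x) - e * q by rewrite addrAC mulrBr cqe.
  rewrite [X in X * _]xE mulrDl addrC; congr (_ + _).
  by rewrite mulrBr mulr1 xE mulrDr ee opprD addNKr.
by rewrite exprMn_comm // qn mul0r.
Qed.

Lemma unipotent_torsion t n :
  nilpotent_elt t -> (1 - t) ^+ n = 1 -> exists k, t *+ n ^ k = 0.
Proof.
move=> [m tm] tn1.
(* Each [(1 - t) ^+ i] is 1 minus [t] times a geometric sum, so the powers with [i < n] add up to
   [n%:R - t * v]. Multiplied by [t], this sum becomes [1 - (1 - t) ^+ n = 0], hence
   [t *+ n = t * t * v]. *)
pose v := \sum_(i < n) \sum_(j < i) (1 - t) ^+ j.
have ct1 : GRing.comm t (1 - t) by apply: commrB => //; exact: commr1.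
have ctv : GRing.comm t v.
  by do 2![apply: commr_sum => ? _]; exact: commrX.
have sumE : \sum_(i < n) (1 - t) ^+ i = n%:R - t * v.
  rewrite mulr_sumr -[n in n%:R]card_ord -sumr_const -sumrB.
  apply: eq_bigr => i _; apply/eqP; rewrite eq_sym subr_eq addrC -subr_eq.
  rewrite -opprB subrX1 -mulNr opprB.
  by rewrite opprB addrC subrK.
have ntE : t *+ n = t * t * v.
  have /eqP := subrX1 (1 - t) n.
  rewrite tn1 subrr sumE addrAC subrr add0r mulNr eq_sym oppr_eq0.
  by rewrite mulrBr mulr_natr subr_eq0 mulrA => /eqP.
exists m; suff -> : t *+ n ^ m = t ^+ m.+1 * v ^+ m by rewrite exprSr tm !mul0r.
elim: m {tm} => [|m IH]; first by rewrite mulr1.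
rewrite expnSr mulrnA IH exprS -mulrA -mulrnAl ntE.
rewrite [t ^+ m.+2]exprS [t ^+ m.+1]exprS [v ^+ m.+1]exprS -!mulrA.
by congr (t * (t * _)); rewrite !mulrA (commrX m (commr_sym ctv)).
Qed.

(** Powers of [m] and [n] that vanish in [A] are still coprime, so a Bezout relation between them
    reads 1 = 0 in [A]. *)
Lemma coprime_nilpotent_false m n : (0 < m)%N -> coprime m n ->
  nilpotent_elt (m%:R : A) -> nilpotent_elt (n%:R : A) -> False.
Proof.
move=> m0 co [a ma] [b nb].
have ma0 : (0 < m ^ a)%N by rewrite expn_gt0 m0.
have [u _ /dvdnP[w wE]] := Bezoutl (n ^ b) ma0.
have /eqP := congr1 (fun i => i%:R : A) wE.
have /eqP -> : coprime (m ^ a) (n ^ b) by apply/coprimeXl/coprimeXr.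
by rewrite natrD !natrM !natrX ma nb !mulr0 addr0 oner_eq0.
Qed.

End Nilpotent.

Section GroupRing.
Context (R : nzRingType) (G : groupType).
Implicit Types (g h : G) (a : group_ring R G).

Definition group_elt g : group_ring R G := << 1 *g g >>.

Lemma group_eltM g h : group_elt (g * h)%g = group_elt g * group_elt h.
Proof. by rewrite [RHS]group_ring_mulUU mulr1. Qed.

Lemma group_eltX g n : group_elt (g ^+ n)%g = group_elt g ^+ n.
Proof. by elim: n => // n IH; rewrite expgS group_eltM IH exprS. Qed.

Lemma group_elt_central : is_abelian G ->
  forall g a, GRing.comm (group_elt g) a.
Proof.
move=> cG g a; rewrite /GRing.comm [a]monalgE.
rewrite [LHS]group_ring_mul_sumr [RHS]group_ring_mul_suml.
apply: eq_bigr => h _.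
by rewrite !group_ring_mulUU mul1r mulr1 cG.
Qed.

Definition augmentation a : R := mmap idfun (fun=> 1) a.

(** Translation by [g] only permutes the support, which preserves the sum of the coefficients. By
    additivity, every multiple [(1 - group_elt g) * a] then has augmentation 0. *)
Lemma augmentation_group_eltM g a :
  augmentation (group_elt g * a) = augmentation a.
Proof.
rewrite [in LHS](monalgE a) [group_elt g * _]group_ring_mul_sumr.
rewrite /augmentation raddf_sum mmapE; apply: eq_bigr => h _.
by rewrite group_ring_mulUU [LHS]mmapU /= mul1r.
Qed.

Lemma sub1_group_elt_nonunit g : ~ two_sided_unit (1 - group_elt g).
Proof.
move=> [a [ga1 _]]; have /eqP := congr1 augmentation ga1.
rewrite mulrBl mul1r [augmentation (_ - _)]mmapB.
rewrite -/(augmentation _) -/(augmentation (_ * _)) augmentation_group_eltM.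
have -> : augmentation 1 = 1 := etrans (mmapU _ _) (mulr1 _).
by rewrite subrr eq_sym oner_eq0.
Qed.

Lemma mcoeff_sub1_group_elt g : g <> 1%g -> (1 - group_elt g)@_1%g = 1.
Proof.
by move=> /eqP g1; rewrite mcoeffB !mcoeffU (negPf g1) eqxx subr0.
Qed.

Lemma nilpotent_sub1_torsion g : nilpotent_elt (1 - group_elt g) ->
  exists2 n, (0 < n)%N & (g ^+ n = 1)%g.
Proof.
move=> [m gm0].
have [/existsP[i /eqP gi]|/existsPn gN1] :=
  boolP [exists i : 'I_m, (g ^+ i.+1)%g == 1%g]; first by exists i.+1.
have /eqP := congr1 (mcoeff 1%g) gm0; rewrite mcoeff0.
rewrite exprBn_comm; last exact/commr_sym/commr1.
(* In the binomial expansion, the terms of positive index are multiples of powers of [g] other than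
   1; only the term of index 0 reaches the coefficient at 1. *)
rewrite raddf_sum big_ord_recl /= big1 => [|i _].
  by rewrite bin0 !expr0 expr1n !mulr1 addr0 [X in X == _]mcoeffUU oner_eq0.
rewrite mcoeffMn expr1n mulr1 -group_eltX -signr_odd mulr_sign.
by rewrite /group_elt; case: ifP;
  rewrite ?mcoeffN mcoeffU (negPf (gN1 i)) ?oppr0 mul0rn.
Qed.

Lemma nilpotent_sub1_order g n : g <> 1%g -> (g ^+ n = 1)%g ->
  nilpotent_elt (1 - group_elt g) -> nilpotent_elt (n%:R : R).
Proof.
move=> g1 gn nilg; have [|k nk] := @unipotent_torsion _ _ n nilg.
  by rewrite subKr -group_eltX gn.
exists k.
have /eqP := congr1 (mcoeff 1%g) nk.
by rewrite mcoeffMn mcoeff_sub1_group_elt // mcoeff0 natrX => /eqP.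
Qed.

Lemma GNC_nilpotent_sub1 g : is_abelian G -> GNC (group_ring R G) ->
  nilpotent_elt (1 - group_elt g).
Proof.
move=> cG gncRG; have cg := group_elt_central cG g.
have [] := nil_clean_central_nilpotent _ (gncRG _ (@sub1_group_elt_nonunit g)).
  by move=> a; apply/commr_sym/commrB; [exact: commr1 | exact/commr_sym/cg].
move=> n; rewrite subKr exprMn_comm; last first.
  by apply/commr_sym/commrB => //; exact: commr1.
(* The unit [group_elt g ^+ n] is cancelled on the right. *)
move=> /(congr1 (fun a => a * group_elt (g ^- n)%g)).
by rewrite mul0r -mulrA -group_eltX -group_eltM mulgV mulr1; exists n.
Qed.

End GroupRing.

Lemma order_exists (G : groupType) (g : G) n :
  (0 < n)%N -> (g ^+ n = 1)%g -> exists m, has_order g m.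
Proof.
move=> n0 gn.
have ex : exists m, (0 < m)%N && ((g ^+ m)%g == 1%g).
  by exists n; rewrite n0 gn eqxx.
case: (ex_minnP ex) => m /andP[m0 /eqP gm] mmin; exists m; split=> // k.
move=> /andP[k0 km] /eqP gk.
by have := mmin k; rewrite k0 gk leqNgt km => /(_ isT).
Qed.

Lemma has_order_prime_div (G : groupType) (g : G) n q :
  has_order g n -> prime q -> (q %| n)%N ->
  exists2 h : G, h <> 1%g & (h ^+ q = 1)%g.
Proof.
move=> [n0 gn nmin] pq qn; exists (g ^+ (n %/ q))%g; last first.
  by rewrite -expgnA divnK.
(* The exponent [n %/ q] is positive and smaller than the order [n]. *)
apply: nmin; rewrite divn_gt0 ?prime_gt0 // dvdn_leq //=.
by rewrite ltn_Pdiv ?prime_gt1.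
Qed.

Theorem theorem3p8 (R : nzRingType) (G : groupType)
    (G_abelian : is_abelian G) (G_nontrivial : exists g : G, g <> 1%g)
    (RG_GNC : GNC (group_ring R G)) :
  exists p : nat,
    [/\ prime p, nilpotent_elt (p%:R : R)%R & is_pgroup G p].
Proof.
have nil g := GNC_nilpotent_sub1 g G_abelian RG_GNC.
have ord (g : G) : exists n, has_order g n.
  by have [n n0 gn] := nilpotent_sub1_torsion (nil g); exact: order_exists gn.
have nilq (g : G) n q :
    has_order g n -> prime q -> (q %| n)%N -> nilpotent_elt (q%:R : R).
  move=> gn pq qn; have [h h1 hq] := has_order_prime_div gn pq qn.
  exact: nilpotent_sub1_order h1 hq (nil h).
have [g g1] := G_nontrivial; have [n gn] := ord g.
have n1 : (1 < n)%N.
  by case: gn => n0 gn _; case: n n0 gn => [|[|n]] //; rewrite expg1.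
(* The prime sought is the least prime factor of the order of one nontrivial element. *)
have pp := pdiv_prime n1; have nilp := nilq _ _ _ gn pp (pdiv_dvd n).
exists (pdiv n); split=> // h; have [m hm] := ord h.
suff /p_natP[k mE] : (pdiv n).-nat m by exists k; rewrite -mE.
apply/pnatP => [|q pq qm]; first by case: hm.
(* A prime factor [q] of the order of [h] other than [pdiv n] would be coprime to it, while both are
   nilpotent in [R]. *)
apply/eqP; apply: contraTeq isT => qp.
by have := coprime_nilpotent_false (prime_gt0 pq) _ (nilq _ _ _ hm pq qm) nilp;
   rewrite prime_coprime // dvdn_prime2 // qp => /(_ isT).
Qed.
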